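(* Let $(M,d)$ be a nonempty complete metric space and let $U:M\to M$ be a continuous surjective $\varphi$-expansive mapping, with associated non-decreasing function $\varphi:(0,\infty)\to(1,\infty)$. If there exists $\eta>1$ such that $$\varphi(d(Ux,Uz))\geq[\varphi(\min\{d(x,z),d(x,Ux),d(z,Uz)\})]^{\eta}$$ for all $x,z\in M\setminus\{t\in M : Ut=t\}$ with $Ux\neq Uz$, then $U$ has a fixed point.
   Context: For a metric space $(M,d)$ (with no order), a mapping $U:M\to M$ is called $\varphi$-expansive, with associated function $\varphi$, if $\varphi:(0,\infty)\to(1,\infty)$ is a non-decreasing function and there exists a constant $\eta_0>1$ such that $\varphi(d(Ux,Uz))\geq[\varphi(d(x,z))]^{\eta_0}$ for all $x,z\in M$ with $d(Ux,Uz)>0$. *)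

(* Defs.v *)
From HB Require Import structures.
From mathcomp Require Import all_boot all_order all_algebra.
From mathcomp Require Import all_classical all_reals all_analysis.

Set Implicit Arguments.
Unset Strict Implicit.
Unset Printing Implicit Defensive.

Import Order.TTheory GRing.Theory Num.Theory.

Local Open Scope classical_set_scope.
Local Open Scope ring_scope.

(* [Complete] includes [isPointed], so these spaces are nonempty. *)
#[short(type="completeMetricType")]
HB.structure Definition CompleteMetric (R : numDomainType) :=
  {M of Complete M & Metric R M}.

(* [phi : (0, oo) -> (1, oo)] is represented by a total function on [R] whose
   values outside the positive reals are never constrained nor used. *)
Definition nondecreasing_gauge (R : realType) (phi : R -> R) : Prop :=
  (forall t, 0 < t -> 1 < phi t) /\
  (forall s t, 0 < s -> s <= t -> phi s <= phi t).

Definition phi_expansive (R : realType) (M : metricType R) (phi : R -> R)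
    (U : M -> M) : Prop :=
  nondecreasing_gauge phi /\
  exists eta0 : R, 1 < eta0 /\
    forall x z : M, 0 < mdist (U x) (U z) ->
      phi (mdist x z) `^ eta0 <= phi (mdist (U x) (U z)).

(* Main.v *)
Require Import Defs.
From mathcomp Require Import all_boot all_order all_algebra.
From mathcomp Require Import all_classical all_reals all_analysis.
Import Order.TTheory GRing.Theory Num.Theory.
Local Open Scope classical_set_scope.
Local Open Scope ring_scope.

(** A right inverse [g] of the surjection [U] turns expansion into contraction:
    applied to [g x] and [g z] with [x <> z], the expansiveness of [U] reads
    [phi (d (g x) (g z)) `^ eta0 <= phi (d x z)].  A fixed point of [g] is a
    fixed point of [U], so it is enough to find one for [g].

    Because [phi] takes values above 1 and [eta0 > 1], the inequality makes [g]
    strictly decrease distances ([gauge_power_lt]).  More is true: just to the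
    right of any [e > 0] the monotone function [phi] is close to its right limit
    [L], which exceeds 1, so it stays below [L `^ eta0] there, whereas it is at
    least [L] beyond [e].  Hence pairs at distance slightly more than [e] are
    sent to distance at most [e] ([gauge_power_gap]).  These two properties are
    the hypotheses of the Ciric-Matkowski fixed point theorem
    ([ciric_matkowski_fixpoint]), whose proof follows Meir and Keeler: the steps
    of a Picard orbit become arbitrarily small, and once a step is small enough
    the whole remaining orbit is trapped in a small ball, so the orbit is Cauchy
    and its limit is fixed. *)

(** * Monotone gauges and powers *)

Lemma ltr1_powR {R : realType} {a k : R} : 1 < a -> 1 < k -> a < a `^ k.
Proof.
move=> a1 k1; have a0 := lt_trans ltr01 a1.
by rewrite -[ltLHS](powRr1 (ltW a0)) /powR gt_eqF// ltr_expR ltr_pM2r// ln_gt0.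
Qed.

Lemma gauge_power_lt {R : realType} {phi : R -> R} {k s t : R} :
  nondecreasing_gauge phi -> 1 < k -> 0 < s -> 0 < t ->
  phi s `^ k <= phi t -> s < t.
Proof.
move=> [phi_gt1 phi_ndecr] k1 s0 t0 st; rewrite ltNge; apply/negP => ts.
have := ltr1_powR (phi_gt1 _ s0) k1; rewrite ltNge => /negP; apply.
exact: le_trans st (phi_ndecr _ _ t0 ts).
Qed.

(** The right limit [L] of [phi] at [e] satisfies [1 < L < L `^ k]; since [L] is
    an infimum, [phi] takes a value below [L `^ k] at some point beyond [e], and
    [d] is the distance from [e] to that point. *)
Lemma gauge_power_gap {R : realType} {phi : R -> R} {k e : R} :
  nondecreasing_gauge phi -> 1 < k -> 0 < e ->
  exists2 d, 0 < d & forall s t, 0 < t -> t < e + d ->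
    phi s `^ k <= phi t -> s <= e.
Proof.
move=> [phi_gt1 phi_ndecr] k1 e0.
set A := phi @` [set t | e < t].
have A_ge : lbound A (phi e) by move=> _ [t /= et <-]; exact/phi_ndecr/ltW.
have A0 : A !=set0 by exists (phi (e + 1)), (e + 1) => //=; rewrite ltrDl.
have infA : has_inf A by split=> //; exists (phi e).
have L1 : 1 < inf A by rewrite (lt_le_trans (phi_gt1 _ e0))// lb_le_inf.
have L_pow : 0 < inf A `^ k - inf A by rewrite subr_gt0 ltr1_powR.
have [_ [u /= eu <-]] := inf_adherent L_pow infA.
rewrite addrC subrK => phi_u; exists (u - e); first by rewrite subr_gt0.
move=> s t t0; rewrite addrC subrK => tu st.
rewrite leNgt; apply/negP => es.
have L_le : inf A <= phi s by apply: ge_inf; [exact: infA.2 | exists s].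
have : inf A `^ k <= phi s `^ k.
  have L0 : 0 <= inf A := ltW (lt_trans ltr01 L1).
  have k0 : 0 <= k := ltW (lt_trans ltr01 k1).
  by apply: ge0_ler_powR; rewrite ?nnegrE// (le_trans L0).
move=> /le_trans/(_ st)/le_trans/(_ (phi_ndecr _ _ t0 (ltW tu))).
by rewrite leNgt phi_u.
Qed.

(** * The Ciric-Matkowski fixed point theorem *)

Section CiricMatkowski.
Context {R : realType} {M : completeMetricType R} (T : M -> M).

Hypothesis T_contractive :
  forall x y, x <> y -> mdist (T x) (T y) < mdist x y.
Hypothesis T_gap : forall e : R, 0 < e -> exists2 d : R, 0 < d &
  forall x y, e < mdist x y < e + d -> mdist (T x) (T y) <= e.

Lemma contractive_mdist_le x y : mdist (T x) (T y) <= mdist x y.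
Proof.
by have [->|/eqP xy] := eqVneq x y; [rewrite !mdistxx | exact/ltW/T_contractive].
Qed.

Lemma contractive_gap (e : R) : 0 < e -> exists2 d : R, 0 < d &
  forall x y, mdist x y < e + d -> mdist (T x) (T y) <= e.
Proof.
move=> /T_gap[d d0 gap]; exists d => // x y xy.
have [exy|xye] := ltP e (mdist x y); first by apply: gap; rewrite exy.
exact: le_trans (contractive_mdist_le _ _) xye.
Qed.

(** Let [r] be the infimum of the steps.  If [r > 0], a step close enough to [r]
    is followed by a step at most [r], and then by one strictly below [r]. *)
Lemma small_picard_step (x : M) (e : R) : 0 < e ->
  exists n, mdist (iter n T x) (iter n.+1 T x) < e.
Proof.
move=> e0.
set A := range (fun n => mdist (iter n T x) (iter n.+1 T x)).
have infA : has_inf A.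
  split; first by exists (mdist x (T x)), 0%N.
  by exists 0 => _ [n _ <-]; exact: mdist_ge0.
have r_le n : inf A <= mdist (iter n T x) (iter n.+1 T x).
  by apply: ge_inf; [exact: infA.2 | exists n].
have [r0|r0] := leP (inf A) 0.
  have [_ [n _ <-] ne] := inf_adherent e0 infA.
  by exists n; rewrite (lt_le_trans ne)// gerDr.
have [d d0 gap] := contractive_gap _ r0.
have [_ [n _ <-] /gap step_le] := inf_adherent d0 infA.
have neq : iter n.+1 T x <> iter n.+2 T x.
  by apply/eqP; rewrite -mdist_gt0 (lt_le_trans r0)// r_le.
have := lt_le_trans (T_contractive _ _ neq) step_le.
by rewrite ltNge => /negP[]; exact: (r_le n.+2).
Qed.

(** With [d] given by the gap property at [e], a step shorter than [d] traps the
    orbit: a point within [e] plus that step of [y] is at distance less than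
    [e + d], so its image is within [e] of [T y]. *)
Lemma picard_orbit_trapped (e : R) : 0 < e -> exists2 d : R, 0 < d &
  forall y, mdist y (T y) < d ->
    forall n, mdist y (iter n T y) <= mdist y (T y) + e.
Proof.
move=> e0; have [d d0 gap] := contractive_gap _ e0.
exists d => // y yd; elim=> [|n IHn] /=.
  by rewrite mdistxx addr_ge0 ?mdist_ge0// ltW.
apply: le_trans (metric_triangle _ (T y) _) _; rewrite lerD2l; apply: gap.
by apply: le_lt_trans IHn _; rewrite addrC ltrD2l.
Qed.

Lemma cauchy_picard (x : M) : cauchy (iter n T x @[n --> \oo]).
Proof.
apply: cauchy_exP => e e0; have h0 : 0 < e / 2 by rewrite divr_gt0.
have [d d0 trap] := picard_orbit_trapped _ h0.
have m0 : 0 < Num.min d (e / 2) by rewrite lt_min d0 h0.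
have [n] := small_picard_step x _ m0.
rewrite lt_min => /andP[nd nh]; exists (iter n T x).
exists n => //= m /= nm; rewrite ballEmdist /=.
have := trap _ nd (m - n)%N; rewrite -iterD subnK// => /le_lt_trans; apply.
by rewrite [ltRHS]splitr ltrD2r.
Qed.

Lemma ciric_matkowski_fixpoint : exists p, T p = p.
Proof.
have /cauchy_cvg/cvg_ex[/= p xp] := cauchy_picard point.
exists p.
have Txp : iter n.+1 T point @[n --> \oo] --> T p.
  apply/cvg_ballP => e e0.
  have : \forall n \near \oo, ball p e (iter n T point).
    by apply: xp; exact: nbhsx_ballx.
  apply: filterS => n; rewrite !ballEmdist/=.
  exact/le_lt_trans/contractive_mdist_le.
apply: (cvg_unique (@metric_hausdorff R M) Txp).
by move: xp; rewrite -cvg_shiftS.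
Qed.

End CiricMatkowski.

(** * Expansive surjections *)

Theorem theorem2p2 (R : realType) (M : completeMetricType R) (U : M -> M)
    (phi : R -> R)
    (Ucont : continuous U)
    (Usurj : set_surj [set: M] [set: M] U)
    (Uexp : phi_expansive phi U)
    (Umin : exists eta : R, 1 < eta /\
       forall x z : M, U x <> x -> U z <> z -> U x <> U z ->
         phi (Num.min (mdist x z) (Num.min (mdist x (U x)) (mdist z (U z))))
           `^ eta <= phi (mdist (U x) (U z))) :
  exists p : M, U p = p.
Proof.
have [phi_gauge [eta0 [eta0_gt1 U_exp]]] := Uexp.
have /choice[g Ug] : forall y, exists x, U x = y.
  by move=> y; have [x _ <-] := Usurj y I; exists x.
have g_inj : injective g by move=> x z /(congr1 U); rewrite !Ug.
have g_power x z : x <> z ->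
    phi (mdist (g x) (g z)) `^ eta0 <= phi (mdist x z).
  by move=> /eqP xz; have := U_exp (g x) (g z); rewrite !Ug mdist_gt0; exact.
have [||p gp] := @ciric_matkowski_fixpoint R M g.
- move=> x z xz; apply: gauge_power_lt phi_gauge eta0_gt1 _ _ (g_power _ _ xz).
    by rewrite mdist_gt0 (inj_eq g_inj); exact/eqP.
  by rewrite mdist_gt0; exact/eqP.
- move=> e e0; have [d d0 gap] := gauge_power_gap phi_gauge eta0_gt1 e0.
  exists d => // x z /andP[exz xzd].
  have xz0 := lt_trans e0 exz.
  apply: (gap _ _ xz0 xzd); apply: g_power.
  by apply/eqP; rewrite -mdist_gt0.
- by exists p; rewrite -{1}gp Ug.
Qed.
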